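(* Let $\mathcal F$ be an arbitrary division ring and let $A\in\mathcal F^{m\times p}$, $B\in\mathcal F^{m\times q}$, $C\in\mathcal F^{s\times p}$, $D\in\mathcal F^{t\times p}$, $E\in\mathcal F^{p_1\times m_1}$, $F\in\mathcal F^{p_1\times s_1}$, $G\in\mathcal F^{p_1\times t_1}$, $H\in\mathcal F^{q_1\times m_1}$, $\Phi\in\mathcal F^{m\times m_1}$, $\Psi\in\mathcal F^{s\times s_1}$, $\Omega\in\mathcal F^{t\times t_1}$ be given. The system of matrix equations $$AXE+BY+ZH=\Phi,\qquad CXF=\Psi,\qquad DXG=\Omega$$ has a solution $(X,Y,Z)\in\mathcal F^{p\times p_1}\times\mathcal F^{q\times m_1}\times\mathcal F^{m\times q_1}$ if and only if all of the following rank equalities hold: $$\mathrm{r}\begin{pmatrix}\Phi&A&B\\ H&0&0\end{pmatrix}=\mathrm{r}(A,B)+\mathrm{r}(H),\quad \mathrm{r}(C,\Psi)=\mathrm{r}(C),\quad \mathrm{r}(D,\Omega)=\mathrm{r}(D),$$ $$\mathrm{r}\begin{pmatrix}\Phi&B\\ E&0\\ H&0\end{pmatrix}=\mathrm{r}(B)+\mathrm{r}\begin{pmatrix}E\\ H\end{pmatrix},\quad \mathrm{r}\begin{pmatrix}F\\ \Psi\end{pmatrix}=\mathrm{r}(F),\quad \mathrm{r}\begin{pmatrix}G\\ \Omega\end{pmatrix}=\mathrm{r}(G),$$ $$\mathrm{r}\begin{pmatrix}\Phi&0&A&B\\ 0&-\Psi&C&0\\ E&F&0&0\\ H&0&0&0\end{pmatrix}=\mathrm{r}\begin{pmatrix}A&B\\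 C&0\end{pmatrix}+\mathrm{r}\begin{pmatrix}E&F\\ H&0\end{pmatrix},$$ $$\mathrm{r}\begin{pmatrix}\Phi&0&A&B\\ 0&-\Omega&D&0\\ E&G&0&0\\ H&0&0&0\end{pmatrix}=\mathrm{r}\begin{pmatrix}A&B\\ D&0\end{pmatrix}+\mathrm{r}\begin{pmatrix}E&G\\ H&0\end{pmatrix},$$ $$\mathrm{r}\begin{pmatrix}\Psi&0&C\\ 0&-\Omega&D\\ F&G&0\end{pmatrix}=\mathrm{r}\begin{pmatrix}C\\ D\end{pmatrix}+\mathrm{r}(F,G),$$ $$\mathrm{r}\begin{pmatrix}\Phi&0&0&A&A&B\\ 0&-\Psi&0&C&0&0\\ 0&0&-\Omega&0&D&0\\ E&F&G&0&0&0\\ H&0&0&0&0&0\end{pmatrix}=\mathrm{r}\begin{pmatrix}A&A&B\\ C&0&0\\ 0&D&0\end{pmatrix}+\mathrm{r}\begin{pmatrix}E&F&G\\ H&0&0\end{pmatrix},$$ $$\mathrm{r}\begin{pmatrix}\Phi&0&0&A&B\\ 0&-\Psi&0&C&0\\ 0&0&-\Omega&D&0\\ E&F&0&0&0\\ E&0&G&0&0\\ H&0&0&0&0\end{pmatrix}=\mathrm{r}\begin{pmatrix}A&B\\ C&0\\ D&0\end{pmatrix}+\mathrm{r}\begin{pmatrix}E&F&0\\ E&0&G\\ H&0&0\end{pmatrix}.$$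
   Context: $\mathcal F^{m\times n}$ is the set of $m\times n$ matrices over the division ring $\mathcal F$. The rank $\mathrm{r}(\cdot)$ of a matrix over $\mathcal F$ is the dimension of its left row space, equal to the dimension of its right column space. Blocks $0$ denote zero blocks of the appropriate size. *)

(* Defs.v *)
From mathcomp Require Import all_boot all_order all_algebra.
From mathcomp Require Import boolp classical_sets.

Set Implicit Arguments.
Unset Strict Implicit.
Unset Printing Implicit Defensive.

Import GRing.Theory.
Local Open Scope classical_set_scope.
Local Open Scope ring_scope.

(* A [unitRingType] is a nontrivial, not necessarily commutative ring in which
   [GRing.unit] is exactly the set of two-sided invertible elements. *)
Definition division_ring (K : unitRingType) : Prop :=
  forall x : K, x != 0 -> x \is a GRing.unit.

(* [\rank] needs a commutative field, so the rank over a division ring is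
   defined here as the dimension of the left row space. In [u *m A] the entries
   of [u] multiply the rows of [A] on the left. *)
Section LeftRank.
Variable K : unitRingType.

Definition left_row_space m n (A : 'M[K]_(m, n)) : set 'rV[K]_n :=
  range (fun u : 'rV[K]_m => u *m A).

Definition left_free r n (V : 'M[K]_(r, n)) : Prop :=
  forall u : 'rV[K]_r, u *m V = 0 -> u = 0.

(* The family of vectors is given by the rows of [V]. *)
Definition left_basis r n (V : 'M[K]_(r, n)) (S : set 'rV[K]_n) : Prop :=
  left_free V /\ left_row_space V = S.

(* The default value 0 is never used for the row space of a matrix over a
   division ring, and the size of a basis is then unique: see
   [left_rank_basis] and [left_dimE]. *)
Definition left_dim n (S : set 'rV[K]_n) : nat :=
  xget 0%N [set r | exists V : 'M[K]_(r, n), left_basis V S].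

Definition left_rank m n (A : 'M[K]_(m, n)) : nat :=
  left_dim (left_row_space A).

Hypothesis divK : division_ring K.

Lemma left_free_leq r k (U : 'M[K]_(r, k)) : left_free U -> (r <= k)%N.
Proof.
elim: k => [|k IHk] in r U *; move=> freeU.
  case: r U freeU => // r U freeU.
  have /freeU /matrixP /(_ 0 0) : (const_mx 1 : 'rV[K]_r.+1) *m U = 0.
    by apply/matrixP => i [].
  by rewrite !mxE => /eqP; rewrite oner_eq0.
have [U0 | [i Ui0]] : (forall i, U i 0 = 0) \/ exists i, U i 0 != 0.
- have [|U0] := EM (exists i, U i 0 != 0); [by right | left => i].
  by apply/eqP/negPn/negP => Ui0; apply: U0; exists i.
- apply/leqW/(IHk _ (\matrix_(i, j) U i (lift 0 j))) => u uU; apply: freeU.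
  apply/rowP => j; rewrite !mxE; case: (unliftP 0 j) => [j' -> | ->].
    by move/rowP/(_ j'): uU; rewrite !mxE => uU; rewrite -[RHS]uU;
       apply: eq_bigr => l _; rewrite !mxE.
  by rewrite big1 // => l _; rewrite U0 mulr0.
case: r U freeU i Ui0 => [|r] U freeU i Ui0; first by case: i {Ui0}.
have a_unit := divK Ui0; set a := U i 0 in a_unit.
pose c j := U (lift i j) 0 / a.
pose U' := \matrix_(j < r, l < k) (U (lift i j) (lift 0 l) - c j * U i (lift 0 l)).
apply: (IHk _ U') => v vU'.
pose w := \row_l (if unlift i l is Some j then v 0 j
                  else - \sum_j v 0 j * c j) : 'rV[K]_r.+1.
have wUE l : (w *m U) 0 l = \sum_j v 0 j * (U (lift i j) l - c j * U i l).
  rewrite !mxE (bigD1_ord i) //= !mxE unlift_none mulNr mulr_suml addrC -sumrB.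
  by apply: eq_bigr => j _; rewrite !mxE liftK mulrBr [in RHS]mulrA.
have /freeU w0 : w *m U = 0.
  apply/rowP => l; rewrite wUE [RHS]mxE.
  case: (unliftP 0 l) => [l' -> | ->].
    by move/rowP/(_ l'): vU'; rewrite !mxE => vU'; rewrite -[RHS]vU';
       apply: eq_bigr => j _; rewrite !mxE.
  by rewrite big1 // => j _; rewrite /c -/a divrK // subrr mulr0.
by apply/rowP => j; move/rowP/(_ (lift i j)): w0; rewrite !mxE liftK.
Qed.

Lemma left_basis_leq n r s (V : 'M[K]_(r, n)) (W : 'M[K]_(s, n)) :
  left_free V -> left_row_space V `<=` left_row_space W -> (r <= s)%N.
Proof.
move=> freeV sVW.
have sW j : exists u : 'rV[K]_s, u *m W = row j V.
  have [|u _ <-] := sVW (row j V); last by exists u.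
  by exists (delta_mx 0 j) => //; rewrite rowE.
have [f fE] := choice sW; pose X := \matrix_j f j.
have VE : V = X *m W by apply/row_matrixP => j; rewrite row_mul rowK fE.
apply: (@left_free_leq _ _ X) => u uX; apply: freeV.
by rewrite VE mulmxA uX mul0mx.
Qed.

Lemma left_dimE n r (V : 'M[K]_(r, n)) (S : set 'rV[K]_n) :
  left_basis V S -> left_dim S = r.
Proof.
move=> [freeV VS]; apply: xget_unique => [|s [W [freeW WS]]]; first by exists V.
have le_sr : (s <= r)%N by apply: (left_basis_leq freeW (W := V)); rewrite WS VS.
have le_rs : (r <= s)%N by apply: (left_basis_leq freeV (W := W)); rewrite WS VS.
by apply/eqP; rewrite eqn_leq le_sr.
Qed.

Lemma left_row_basis m n (A : 'M[K]_(m, n)) :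
  exists r (V : 'M[K]_(r, n)), left_basis V (left_row_space A).
Proof.
elim: m => [|m IHm] in A *.
  exists 0%N, A; split=> // u _; exact: thinmx0.
rewrite -[m.+1]/(1 + m)%N in A *.
have [r [V [freeV VA]]] := IHm (dsubmx A).
pose a := usubmx A.
have AE : A = col_mx a (dsubmx A) by rewrite vsubmxK.
have mem (u : 'rV_m) : exists w, w *m V = u *m dsubmx A.
  have : left_row_space V (u *m dsubmx A).
    by rewrite VA; exists u.
  by case=> w _ <-; exists w.
have mem' (w : 'rV_r) : exists u, u *m dsubmx A = w *m V.
  have : left_row_space (dsubmx A) (w *m V).
    by rewrite -VA; exists w.
  by case=> u _ <-; exists u.
have spanE : left_row_space A = left_row_space (col_mx a V).
  rewrite {1}AE; apply/seteqP; split=> _ [u _ <-].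
    have [w wE] := mem (rsubmx u).
    exists (row_mx (lsubmx u) w) => //.
    by rewrite mul_row_col wE -mul_row_col hsubmxK.
  have [w wE] := mem' (rsubmx u).
  exists (row_mx (lsubmx u) w) => //.
  by rewrite mul_row_col wE -mul_row_col hsubmxK.
rewrite spanE.
have [[w wa]|aV] := EM (exists w, w *m V = a).
  exists r, V; split=> //; apply/seteqP; split=> _ [u _ <-].
    by exists (row_mx 0 u) => //; rewrite mul_row_col mul0mx add0r.
  exists (lsubmx u *m w + rsubmx u) => //.
  by rewrite mulmxDl -mulmxA wa -mul_row_col hsubmxK.
exists (1 + r)%N, (col_mx a V); split=> // u.
rewrite -[u]hsubmxK mul_row_col [lsubmx u]mx11_scalar mul_scalar_mx.
set c := lsubmx u 0 0; have [->|/divK Uc] := eqVneq c 0.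
  by rewrite scale0r add0r => /freeV->; rewrite raddf0 row_mx0.
move=> uaV; case: aV; exists (- c^-1 *: rsubmx u).
have -> : a = c^-1 *: (c *: a) by rewrite scalerA mulVr // scale1r.
by rewrite -scalemxAl -(addr0_eq uaV) scalerN scaleNr opprK.
Qed.

Lemma left_rank_basis m n (A : 'M[K]_(m, n)) :
  exists V : 'M[K]_(left_rank A, n), left_basis V (left_row_space A).
Proof.
have [r [V VA]] := left_row_basis A.
by rewrite /left_rank (left_dimE VA); exists V.
Qed.

End LeftRank.

Notation "[ 'hblock' x , .. , y , z ]" :=
  (row_mx x .. (row_mx y z) ..) : ring_scope.
Notation "[ 'vblock' x ; .. ; y ; z ]" :=
  (col_mx x .. (col_mx y z) ..) : ring_scope.

(* Main.v *)
(** Rows are vectors, so a matrix [X] is a linear map [x |-> x *m X]. Each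
   equation asks that on a subspace [U_i] ([{u A | u B = 0}], the row space of
   [C], that of [D]) the map [X] agrees with a prescribed map into a quotient of
   [K^p1] (by [{w | w E in the row space of H}], the left kernel of [F], that of
   [G]). Such a prescription is a linear relation [R_i] with domain [U_i].

   A rank equality [r(M A; B 0) = r(A) + r(B)] says that [u A = 0] forces [u M]
   into the row space of [B]. Read this way, the rank conditions say that the
   [R_i] have domain [U_i] and the right indeterminacy, that any two of them, and
   all three, have a common value at each common point of their domains, and that
   [x1 + x2 + x3 = 0] with [x_i] in [U_i] lifts to values of sum zero.

   Then [X] is built by successive corrections: first make the [R_i] contain
   [(x, 0)] for [x] in the triple intersection of the domains, then in the
   pairwise intersections, then in each [U_i] intersected with the sum of the two
   others; after that, linear selections of the [R_i] glue. *)
Require Import Defs.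
From mathcomp Require Import all_boot all_order all_algebra.
From mathcomp Require Import boolp classical_sets.

Set Implicit Arguments.
Unset Strict Implicit.
Unset Printing Implicit Defensive.

Import GRing.Theory.
Local Open Scope ring_scope.

(** * Linear relations between spaces of row vectors, and their linear selections *)

Section LinearRelations.
Variable K : unitRingType.

Definition lin_pred n (P : 'rV[K]_n -> Prop) : Prop :=
  P 0 /\ forall c x y, P x -> P y -> P (c *: x + y).

(** Such an [R] is a left subspace of the product of the two spaces, that is, a multivalued linear
    map: two values at the same [x] differ by a value at 0. *)
Definition lin_rel n k (R : 'rV[K]_n -> 'rV[K]_k -> Prop) : Prop :=
  R 0 0 /\
  forall c x y w v, R x w -> R y v -> R (c *: x + y) (c *: w + v).

Definition rel_dom n k (R : 'rV[K]_n -> 'rV[K]_k -> Prop) : 'rV[K]_n -> Prop :=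
  fun x => exists w, R x w.

(** This is [R] corrected by the linear map [X]: a selection [Y] of the shifted relation gives the
    selection [Y + X] of [R]. *)
Definition shift n k (R : 'rV[K]_n -> 'rV[K]_k -> Prop) (X : 'M[K]_(n, k)) :=
  fun x w => R x (w + x *m X).

Definition rel_cap n k (R S : 'rV[K]_n -> 'rV[K]_k -> Prop) :=
  fun x w => R x w /\ S x w.

Lemma addr3ACA (V : zmodType) (a b c a' b' c' : V) :
  a + a' + (b + b') + (c + c') = a + b + c + (a' + b' + c').
Proof. by rewrite [X in X + _ = _]addrACA [LHS]addrACA. Qed.

Lemma lin_relD n k (R : 'rV[K]_n -> 'rV[K]_k -> Prop) x y w v :
  lin_rel R -> R x w -> R y v -> R (x + y) (w + v).
Proof. by move=> [_ RL] Rx Ry; have := RL 1 _ _ _ _ Rx Ry; rewrite !scale1r. Qed.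

Lemma lin_relB n k (R : 'rV[K]_n -> 'rV[K]_k -> Prop) x y w v :
  lin_rel R -> R x w -> R y v -> R (x - y) (w - v).
Proof.
move=> [_ RL] Rx Ry; have := RL (- 1) _ _ _ _ Ry Rx.
by rewrite !scaleN1r ![- _ + _]addrC.
Qed.

Lemma lin_relN n k (R : 'rV[K]_n -> 'rV[K]_k -> Prop) x w :
  lin_rel R -> R x w -> R (- x) (- w).
Proof.
by move=> RL Rx; rewrite -[- x]add0r -[- w]add0r; apply: lin_relB => //; case: RL.
Qed.

Lemma lin_pred_dom n k (R : 'rV[K]_n -> 'rV[K]_k -> Prop) :
  lin_rel R -> lin_pred (rel_dom R).
Proof.
move=> [R0 RL]; split=> [|c x y [w Rx] [v Ry]]; first by exists 0.
by exists (c *: w + v); apply: RL.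
Qed.

Lemma lin_predB n (P : 'rV[K]_n -> Prop) x y :
  lin_pred P -> P x -> P y -> P (x - y).
Proof.
by move=> [_ PL] Px Py; have := PL (- 1) _ _ Py Px; rewrite scaleN1r addrC.
Qed.

Lemma lin_predD n (P : 'rV[K]_n -> Prop) x y :
  lin_pred P -> P x -> P y -> P (x + y).
Proof. by move=> [_ PL] Px Py; have := PL 1 _ _ Px Py; rewrite scale1r. Qed.

Lemma lin_predN n (P : 'rV[K]_n -> Prop) x : lin_pred P -> P x -> P (- x).
Proof.
by move=> PL Px; rewrite -[- x]add0r; apply: lin_predB => //; case: PL.
Qed.

Lemma lin_pred_cap n (P Q : 'rV[K]_n -> Prop) :
  lin_pred P -> lin_pred Q -> lin_pred (fun x => P x /\ Q x).
Proof.
move=> [P0 PL] [Q0 QL]; split=> // c x y [Px Qx] [Py Qy].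
by split; [apply: PL | apply: QL].
Qed.

Lemma lin_rel_cap n k (R S : 'rV[K]_n -> 'rV[K]_k -> Prop) :
  lin_rel R -> lin_rel S -> lin_rel (rel_cap R S).
Proof.
move=> [R0 RL] [S0 SL]; split=> // c x y w v [Rx Sx] [Ry Sy].
by split; [apply: RL | apply: SL].
Qed.

Lemma lin_rel_shift n k (R : 'rV[K]_n -> 'rV[K]_k -> Prop) X :
  lin_rel R -> lin_rel (shift R X).
Proof.
move=> [R0 RL]; split=> [|c x y w v Rx Ry]; first by rewrite /shift mul0mx addr0.
by rewrite /shift mulmxDl -scalemxAl addrACA -scalerDr; apply: RL.
Qed.

Lemma rel_dom_shift n k (R : 'rV[K]_n -> 'rV[K]_k -> Prop) X :
  rel_dom (shift R X) = rel_dom R.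
Proof.
apply/funext => x; apply/propext; split=> -[w Rw]; first by exists (w + x *m X).
by exists (w - x *m X); rewrite /shift subrK.
Qed.

Hypothesis divK : division_ring K.

(* Gaussian elimination on the first coordinate; a pivot is taken in [P] with
   value 0 whenever possible. *)
Lemma lin_rel_select n k (R : 'rV[K]_n -> 'rV[K]_k -> Prop)
    (P : 'rV[K]_n -> Prop) :
  lin_rel R -> lin_pred P -> (forall x, P x -> R x 0) ->
  exists X : 'M[K]_(n, k),
    (forall x, rel_dom R x -> R x (x *m X)) /\ (forall x, P x -> x *m X = 0).
Proof.
elim: n => [|n IHn] in R P * => linR linP PR.
  exists 0; split=> x _; last by rewrite mulmx0.
  by rewrite [x]thinmx0 mul0mx; case: linR.
have [R0 RL] := linR; have [P0 PL] := linP.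
rewrite -[n.+1]/(1 + n)%N in R P linR linP PR R0 RL P0 PL *.
have [|||X' [RX' PX']] := IHn (fun y w => R (row_mx 0 y) w) (fun y => P (row_mx 0 y)).
- split=> [|c x y w v Rx Ry]; first by rewrite row_mx0.
  by have := RL c _ _ _ _ Rx Ry; rewrite scale_row_mx add_row_mx scaler0 addr0.
- split=> [|c x y Px Py]; first by rewrite row_mx0.
  by have := PL c _ _ Px Py; rewrite scale_row_mx add_row_mx scaler0 addr0.
- by move=> x /PR.
have xE (x : 'rV[K]_(1 + n)) :
    x = row_mx (x 0 ord0)%:M (rsubmx x).
  rewrite -[LHS]hsubmxK [lsubmx x]mx11_scalar; congr (row_mx _%:M _).
  by rewrite !mxE; congr (x _ _); apply/val_inj.
(* The matrix below sends the pivot [row_mx 1%:M y0] to [w0] and acts as [X'] on the hyperplane of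
   first coordinate 0; every vector is a multiple of the pivot plus a vector of that hyperplane. *)
have pivot y0 w0 : R (row_mx 1%:M y0) w0 ->
    (P (row_mx 1%:M y0) /\ w0 = 0) \/ (forall x, P x -> x 0 ord0 = 0) ->
    exists X : 'M[K]_(1 + n, k),
    (forall x, rel_dom R x -> R x (x *m X)) /\ (forall x, P x -> x *m X = 0).
  move=> Rx0 x0P; exists (col_mx (w0 - y0 *m X') X').
  have subE (x : 'rV[K]_(1 + n)) : x - x 0 ord0 *: row_mx 1%:M y0
      = row_mx 0 (rsubmx x - x 0 ord0 *: y0).
    rewrite {1}[x]xE scale_row_mx scale_scalar_mx mulr1.
    by rewrite opp_row_mx add_row_mx subrr.
  have mulE (x : 'rV[K]_(1 + n)) : x *m col_mx (w0 - y0 *m X') X'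
      = (rsubmx x - x 0 ord0 *: y0) *m X' + x 0 ord0 *: w0.
    rewrite {1}[x]xE mul_row_col mul_scalar_mx scalerBr mulmxBl -scalemxAl.
    by rewrite addrC addrA addrAC.
  split=> x.
    move=> [w Rx]; rewrite mulE.
    have Rcx0 : R (x 0 ord0 *: row_mx 1%:M y0) (x 0 ord0 *: w0).
      by rewrite -[_ *: row_mx _ _]addr0 -[_ *: w0]addr0; apply: RL.
    rewrite -[X in R X _](subrK (x 0 ord0 *: row_mx 1%:M y0)).
    apply: (lin_relD linR _ Rcx0); rewrite subE; apply: RX'.
    by exists (w - x 0 ord0 *: w0); rewrite -subE; apply: lin_relB.
  move=> Px; rewrite mulE; case: x0P => [[Px0 ->]|x0P].
    rewrite scaler0 addr0; apply: PX'; rewrite -subE; apply: lin_predB => //.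
    by rewrite -[_ *: row_mx _ _]addr0; apply: PL.
  rewrite x0P // !scale0r addr0 subr0; apply: PX'.
  by have := Px; rewrite {1}[x]xE x0P // raddf0.
have normalize x w : R x w -> x 0 ord0 != 0 ->
    R (row_mx 1%:M ((x 0 ord0)^-1 *: rsubmx x)) ((x 0 ord0)^-1 *: w).
  move=> Rx /divK x0; have := RL (x 0 ord0)^-1 _ _ _ _ Rx R0.
  by rewrite !addr0 {2}[x]xE scale_row_mx scale_scalar_mx mulVr //.
have [[x [Px x0]]|P00] := EM (exists x, P x /\ x 0 ord0 != 0).
  apply: (pivot _ _ (normalize _ _ (PR _ Px) x0)); left; split; last exact: scaler0.
  have := PL (x 0 ord0)^-1 _ _ Px P0.
  by rewrite addr0 {2}[x]xE scale_row_mx scale_scalar_mx mulVr ?divK.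
have {}P00 x : P x -> x 0 ord0 = 0.
  by move=> Px; apply: contrapT => /eqP x0; apply: P00; exists x.
have [[x [w [Rx x0]]]|R00] := EM (exists x w, R x w /\ x 0 ord0 != 0).
  by apply: (pivot _ _ (normalize _ _ Rx x0)); right.
(* Without a pivot, both [P] and the domain of [R] lie in the hyperplane, so the first row is
   arbitrary. *)
exists (col_mx 0 X'); split=> [x [w Rx]|x Px].
  have x0 : x 0 ord0 = 0.
    by apply: contrapT => /eqP x0; apply: R00; exists x, w.
  rewrite [x]xE x0 raddf0 mul_row_col mul0mx add0r; apply: RX'.
  by exists w; rewrite -(raddf0 scalar_mx) -x0 -xE.
rewrite [x]xE mul_row_col mulmx0 add0r; apply: PX'.
by rewrite -(raddf0 scalar_mx) -(P00 x Px) -xE.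
Qed.

(** Relating each sum [x1 + x2 + x3] to [x1 *m X1 + x2 *m X2 + x3 *m X3] gives a linear relation.
    Compatibility on zero sums makes it single-valued, so any selection of it extends the three maps
    at once. *)
Lemma lin_glue n k (P1 P2 P3 : 'rV[K]_n -> Prop) (X1 X2 X3 : 'M[K]_(n, k)) :
  lin_pred P1 -> lin_pred P2 -> lin_pred P3 ->
  (forall x1 x2 x3, P1 x1 -> P2 x2 -> P3 x3 -> x1 + x2 + x3 = 0 ->
     x1 *m X1 + x2 *m X2 + x3 *m X3 = 0) ->
  exists X : 'M[K]_(n, k), [/\ forall x, P1 x -> x *m X = x *m X1,
    forall x, P2 x -> x *m X = x *m X2 & forall x, P3 x -> x *m X = x *m X3].
Proof.
move=> P1L P2L P3L X0.
pose R (x : 'rV[K]_n) w := exists x1 x2 x3, [/\ P1 x1, P2 x2, P3 x3,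
  x = x1 + x2 + x3 & w = x1 *m X1 + x2 *m X2 + x3 *m X3].
have [P10 P1Z] := P1L; have [P20 P2Z] := P2L; have [P30 P3Z] := P3L.
have RL : lin_rel R.
  split; first by exists 0, 0, 0; rewrite !mul0mx !addr0.
  move=> c _ _ _ _ [x1 [x2 [x3 [? ? ? -> ->]]]] [y1 [y2 [y3 [? ? ? -> ->]]]].
  exists (c *: x1 + y1), (c *: x2 + y2), (c *: x3 + y3).
  split; [exact: P1Z | exact: P2Z | exact: P3Z | |].
    by rewrite !scalerDr addr3ACA.
  by rewrite !mulmxDl -!scalemxAl !scalerDr addr3ACA.
have [||X [RX _]] := @lin_rel_select _ _ R (fun x => x = 0) RL.
- by split=> // c x y -> ->; rewrite scaler0 addr0.
- by move=> x ->; case: RL.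
have fin x1 x2 x3 : P1 x1 -> P2 x2 -> P3 x3 ->
    (x1 + x2 + x3) *m X = x1 *m X1 + x2 *m X2 + x3 *m X3.
  move=> Px1 Px2 Px3; have [|y1 [y2 [y3 [Py1 Py2 Py3 xE ->]]]] := RX (x1 + x2 + x3).
    by exists (x1 *m X1 + x2 *m X2 + x3 *m X3), x1, x2, x3.
  apply/esym/subr0_eq; rewrite !opprD -addr3ACA -!mulmxBl.
  apply: X0; try exact: lin_predB.
  by rewrite addr3ACA xE -!opprD subrr.
exists X; split=> x Px.
- by have := fin x 0 0 Px P20 P30; rewrite !mul0mx !addr0.
- by have := fin 0 x 0 P10 Px P30; rewrite !mul0mx !addr0 !add0r.
- by have := fin 0 0 x P10 P20 Px; rewrite !mul0mx !add0r.
Qed.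
(** Choosing the value 0 wherever the relation admits it is what makes the later gluings compatible:
    at the points to be compared, all selections vanish. *)
Lemma lin_rel_select_null n k (R : 'rV[K]_n -> 'rV[K]_k -> Prop) :
  lin_rel R -> exists X : 'M[K]_(n, k),
    (forall x, rel_dom R x -> R x (x *m X)) /\ (forall x, R x 0 -> x *m X = 0).
Proof.
move=> RL; apply: lin_rel_select => //; split=> [|c x y Rx Ry]; first by case: RL.
by case: RL => _ /(_ c _ _ _ _ Rx Ry); rewrite scaler0 addr0.
Qed.

(** * Common linear selections of three linear relations *)

Section ThreeRelations.
Variables n k : nat.
Implicit Types R S : 'rV[K]_n -> 'rV[K]_k -> Prop.

Definition pair_lift R S : Prop :=
  forall x, rel_dom R x -> rel_dom S x -> rel_dom (rel_cap R S) x.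

Definition zero_sum R1 R2 R3 (x1 x2 x3 : 'rV[K]_n) : Prop :=
  [/\ rel_dom R1 x1, rel_dom R2 x2, rel_dom R3 x3 & x1 + x2 + x3 = 0].

Definition sum_lift R1 R2 R3 : Prop :=
  forall x1 x2 x3, zero_sum R1 R2 R3 x1 x2 x3 ->
  exists w1 w2 w3, [/\ R1 x1 w1, R2 x2 w2, R3 x3 w3 & w1 + w2 + w3 = 0].

Definition common_lift R1 R2 R3 : Prop :=
  exists X : 'M[K]_(n, k), [/\ forall x, rel_dom R1 x -> R1 x (x *m X),
    forall x, rel_dom R2 x -> R2 x (x *m X)
  & forall x, rel_dom R3 x -> R3 x (x *m X)].

Lemma common_lift_shift R1 R2 R3 X :
  common_lift (shift R1 X) (shift R2 X) (shift R3 X) -> common_lift R1 R2 R3.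
Proof.
case=> Y; rewrite !rel_dom_shift /shift => -[Y1 Y2 Y3]; exists (Y + X).
by split=> x Rx; rewrite mulmxDr; auto.
Qed.

(** The selections that prefer 0 vanish on all members of zero-sum triples, hence they glue. *)
Lemma common_lift_zero_sum R1 R2 R3 : lin_rel R1 -> lin_rel R2 -> lin_rel R3 ->
  (forall x1 x2 x3, zero_sum R1 R2 R3 x1 x2 x3 ->
     [/\ R1 x1 0, R2 x2 0 & R3 x3 0]) ->
  common_lift R1 R2 R3.
Proof.
move=> L1 L2 L3 R0.
have [X1 [RX1 X10]] := lin_rel_select_null L1.
have [X2 [RX2 X20]] := lin_rel_select_null L2.
have [X3 [RX3 X30]] := lin_rel_select_null L3.
have [||||X [XX1 XX2 XX3]] := @lin_glue _ _ (rel_dom R1) (rel_dom R2) (rel_dom R3) X1 X2 X3;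
  try exact: lin_pred_dom.
  move=> x1 x2 x3 Rx1 Rx2 Rx3 x0; have [|x10 x20 x30] := R0 x1 x2 x3; first by split.
  by rewrite X10 // X20 // X30 // !addr0.
by exists X; split=> x Rx; [rewrite XX1 | rewrite XX2 | rewrite XX3]; auto.
Qed.

(** One member of a zero-sum triple determines the other two up to pairwise intersections of
    domains, where 0 is an admissible value. Hence a single [X] can take admissible values on all
    zero-sum triples, and shifting by it reduces to [common_lift_zero_sum]. *)
Lemma common_lift_pair_null R1 R2 R3 : lin_rel R1 -> lin_rel R2 -> lin_rel R3 ->
  (forall x, rel_dom R1 x -> rel_dom R2 x -> R1 x 0 /\ R2 x 0) ->
  (forall x, rel_dom R1 x -> rel_dom R3 x -> R1 x 0 /\ R3 x 0) ->
  (forall x, rel_dom R2 x -> rel_dom R3 x -> R2 x 0 /\ R3 x 0) ->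
  sum_lift R1 R2 R3 -> common_lift R1 R2 R3.
Proof.
move=> L1 L2 L3 N12 N13 N23 lift3.
have D1 := lin_pred_dom L1; have D2 := lin_pred_dom L2; have D3 := lin_pred_dom L3.
have zsZ c x1 x2 x3 y1 y2 y3 : zero_sum R1 R2 R3 x1 x2 x3 ->
    zero_sum R1 R2 R3 y1 y2 y3 ->
    zero_sum R1 R2 R3 (c *: x1 + y1) (c *: x2 + y2) (c *: x3 + y3).
  case: D1 D2 D3 => [_ D1] [_ D2] [_ D3] [Rx1 Rx2 Rx3 x0] [Ry1 Ry2 Ry3 y0].
  split; [exact: D1 | exact: D2 | exact: D3 |].
  by rewrite addr3ACA -!scalerDr x0 y0 scaler0 addr0.
have zs0 : zero_sum R1 R2 R3 0 0 0.
  by case: D1 D2 D3 => [? _] [? _] [? _]; split=> //; rewrite !addr0.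
(* [Q] sends the first member of a zero-sum triple to the values at the first
   two, so that the lifts of a triple depend linearly on its first member. *)
pose Q x (v : 'rV[K]_(k + k)) := exists x2 x3, [/\ x + x2 + x3 = 0,
  R1 x (lsubmx v), R2 x2 (rsubmx v) & R3 x3 (- (lsubmx v + rsubmx v))].
have QL : lin_rel Q.
  split; first by exists 0, 0; rewrite !raddf0 !addr0 oppr0; case: L1 L2 L3 => [? _] [? _] [? _].
  move=> c x y w v [x2 [x3 [x0 Rx1 Rx2 Rx3]]] [y2 [y3 [y0 Ry1 Ry2 Ry3]]].
  exists (c *: x2 + y2), (c *: x3 + y3); case: L1 L2 L3 => [_ L1] [_ L2] [_ L3].
  rewrite !linearP /=; split; [|exact: L1|exact: L2|].
    by rewrite addr3ACA -!scalerDr x0 y0 scaler0 addr0.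
  by rewrite addrACA opprD -scalerDr -scalerN; apply: L3.
have [M [QM M0]] := lin_rel_select_null QL.
pose f1 := lsubmx M; pose f2 := rsubmx M.
(* [QM] provides some [b'] and [c'] instead of [b] and [c]; the difference [b - b' = c' - c] lies in
   the domains of both [R2] and [R3], which therefore admit 0 there. *)
have lift_f a b c : zero_sum R1 R2 R3 a b c ->
    [/\ R1 a (a *m f1), R2 b (a *m f2) & R3 c (- (a *m f1 + a *m f2))].
  move=> zs; have [w1 [w2 [w3 [Rw1 Rw2 Rw3 w0]]]] := lift3 _ _ _ zs.
  have [Ra Rb Rc s0] := zs.
  have [|b' [c' [s0' ]]] := QM a.
    exists (row_mx w1 w2), b, c; rewrite row_mxKl row_mxKr; split=> //.
    by rewrite (addr0_eq w0).
  rewrite -mulmx_lsub -mulmx_rsub -/f1 -/f2 => Rf1 Rf2 Rf3.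
  have bc : b - b' = c' - c.
    have /addrI bc : a + (b + c) = a + (b' + c') by rewrite !addrA s0.
    by apply/eqP; rewrite subr_eq addrAC eq_sym subr_eq [c' + b']addrC bc.
  have [||R2b R3b] := N23 (b - b').
  - by apply: (lin_predB D2) => //; exists (a *m f2).
  - by rewrite bc; apply: (lin_predB D3) => //; exists (- (a *m f1 + a *m f2)).
  split=> //.
    by rewrite -[b](subrK b') -[a *m f2]add0r; apply: lin_relD.
  rewrite -[c](subKr c') -bc.
  by rewrite -[X in R3 _ X]subr0; apply: lin_relB.
(* If [b] is in the domain of [R1], so is [c]. Then 0 is admissible at all three members, [Q a 0]
   holds, and [M] vanishes at [a]. *)
have null_f a b c : zero_sum R1 R2 R3 a b c -> rel_dom R1 b ->
    a *m f1 = 0 /\ a *m f2 = 0.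
  move=> [Ra Rb Rc s0] R1b.
  have aE : a = - (b + c) by apply/eqP; rewrite -addr_eq0 addrA s0.
  have R1c : rel_dom R1 c.
    rewrite -[c](addKr b) -[b + c]opprK -aE addrC -opprD.
    by apply: lin_predN => //; apply: lin_predD.
  have [R1b0 R2b0] := N12 _ R1b Rb; have [R1c0 R3c0] := N13 _ R1c Rc.
  have : a *m M = 0.
    apply: M0; exists b, c; rewrite !raddf0 addr0 oppr0; split=> //.
    rewrite aE -[X in R1 _ X]oppr0 -[X in R1 _ (- X)]addr0.
    by apply: lin_relN => //; apply: lin_relD.
  by rewrite mulmx_lsub mulmx_rsub => ->; rewrite !raddf0.
(* Two triples with the same [b] differ by a triple with second member 0, to which [null_f] applies;
   so [a *m f2] depends on [b] only. *)
have [g2 bg2] : exists g2 : 'M[K]_(n, k),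
    forall a b c, zero_sum R1 R2 R3 a b c -> b *m g2 = a *m f2.
  have [|g2 [Rg2 _]] := @lin_rel_select_null _ _
    (fun b w => exists a c, zero_sum R1 R2 R3 a b c /\ w = a *m f2).
  - split; first by exists 0, 0; rewrite mul0mx.
    move=> c x y _ _ [x1 [x3 [zx ->]]] [y1 [y3 [zy ->]]].
    exists (c *: x1 + y1), (c *: x3 + y3); split; first exact: zsZ.
    by rewrite mulmxDl scalemxAl.
  exists g2 => a b c zs; have [|a' [c' [zs' ->]]] := Rg2 b.
    by exists (a *m f2), a, c.
  have [] := null_f (a' - a) (b - b) (c' - c).
  - have := zsZ (-1) _ _ _ _ _ _ zs zs'.
    by rewrite !scaleN1r ![- _ + _]addrC.
  - by rewrite subrr; case: D1.
  by rewrite !mulmxBl => _ /subr0_eq.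
(* Gluing [f1] on first members with [g2] on second members fixes the value at third members, as
   [c = - (a + b)]. Compatibility is [null_f] for triples with third member 0. *)
have [||||X [X1 X2 _]] := @lin_glue _ _
    (fun x => exists b c, zero_sum R1 R2 R3 x b c)
    (fun x => exists a c, zero_sum R1 R2 R3 a x c) (fun x => x = 0) f1 g2 0.
- split=> [|c x y [x2 [x3 zx]] [y2 [y3 zy]]]; first by exists 0, 0.
  by exists (c *: x2 + y2), (c *: x3 + y3); apply: zsZ.
- split=> [|c x y [x1 [x3 zx]] [y1 [y3 zy]]]; first by exists 0, 0.
  by exists (c *: x1 + y1), (c *: x3 + y3); apply: zsZ.
- by split=> // c x y -> ->; rewrite scaler0 addr0.
- move=> a b c [b' [c' [Ra _ _ _]]] [a' [c'' [_ Rb _ _]]] -> s0.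
  have zs : zero_sum R1 R2 R3 a b 0 by split=> //; case: D3.
  have Rb1 : rel_dom R1 b.
    by move: s0; rewrite addr0 => /addr0_eq <-; apply: lin_predN.
  by have [a1 a2] := null_f _ _ _ zs Rb1; rewrite a1 (bg2 _ _ _ zs) a2 mul0mx !addr0.
apply: (@common_lift_shift _ _ _ X); apply: common_lift_zero_sum;
  try exact: lin_rel_shift.
move=> a b c; rewrite /zero_sum !rel_dom_shift /shift !add0r => zs.
have [Rf1 Rf2 Rf3] := lift_f _ _ _ zs.
have aX : a *m X = a *m f1 by apply: X1; exists b, c.
have bX : b *m X = a *m f2 by rewrite X2 ?(bg2 _ _ _ zs) //; exists a, c.
have -> : c *m X = - (a *m f1 + a *m f2).
  by case: zs => _ _ _ /addr0_eq <-; rewrite mulNmx mulmxDl aX bX.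
by rewrite aX bX.
Qed.

(** If points of the three pairwise intersections sum to 0, each of them lies in all three domains,
    where the selections preferring 0 vanish. So the selections on the pairwise intersections glue,
    and shifting by the result reduces to [common_lift_pair_null]. *)
Lemma common_lift_triple_null R1 R2 R3 : lin_rel R1 -> lin_rel R2 -> lin_rel R3 ->
  (forall x, rel_dom R1 x -> rel_dom R2 x -> rel_dom R3 x ->
     [/\ R1 x 0, R2 x 0 & R3 x 0]) ->
  pair_lift R1 R2 -> pair_lift R1 R3 -> pair_lift R2 R3 ->
  sum_lift R1 R2 R3 -> common_lift R1 R2 R3.
Proof.
move=> L1 L2 L3 N P12 P13 P23 lift3.
have D1 := lin_pred_dom L1; have D2 := lin_pred_dom L2; have D3 := lin_pred_dom L3.
have [X12 [RX12 X120]] := lin_rel_select_null (lin_rel_cap L1 L2).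
have [X13 [RX13 X130]] := lin_rel_select_null (lin_rel_cap L1 L3).
have [X23 [RX23 X230]] := lin_rel_select_null (lin_rel_cap L2 L3).
have [||||X [X1 X2 X3]] := @lin_glue _ _
    (fun x => rel_dom R1 x /\ rel_dom R2 x) (fun x => rel_dom R1 x /\ rel_dom R3 x)
    (fun x => rel_dom R2 x /\ rel_dom R3 x) X12 X13 X23;
  try exact: lin_pred_cap.
  move=> a b c [R1a R2a] [R1b R3b] [R2c R3c] s0.
  have aE : a = - (b + c) by apply/eqP; rewrite -addr_eq0 addrA s0.
  have bE : b = - (a + c) by apply/eqP; rewrite -addr_eq0 addrA [b + a]addrC s0.
  have cE : c = - (a + b) by rewrite (addr0_eq s0).
  have R3a : rel_dom R3 a by rewrite aE; apply: lin_predN => //; apply: lin_predD.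
  have R2b : rel_dom R2 b by rewrite bE; apply: lin_predN => //; apply: lin_predD.
  have R1c : rel_dom R1 c by rewrite cE; apply: lin_predN => //; apply: lin_predD.
  have [a1 a2 a3] := N _ R1a R2a R3a; have [b1 b2 b3] := N _ R1b R2b R3b.
  have [c1 c2 c3] := N _ R1c R2c R3c.
  by rewrite X120 // X130 // X230 // !addr0.
have RX1 x : rel_dom R1 x -> rel_dom R2 x -> R1 x (x *m X) /\ R2 x (x *m X).
  by move=> R1x R2x; rewrite X1 //; apply/RX12/P12.
have RX2 x : rel_dom R1 x -> rel_dom R3 x -> R1 x (x *m X) /\ R3 x (x *m X).
  by move=> R1x R2x; rewrite X2 //; apply/RX13/P13.
have RX3 x : rel_dom R2 x -> rel_dom R3 x -> R2 x (x *m X) /\ R3 x (x *m X).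
  by move=> R1x R2x; rewrite X3 //; apply/RX23/P23.
apply: (@common_lift_shift _ _ _ X); apply: common_lift_pair_null;
  rewrite ?rel_dom_shift; try exact: lin_rel_shift.
- by rewrite /shift => x ? ?; rewrite add0r; apply: RX1.
- by rewrite /shift => x ? ?; rewrite add0r; apply: RX2.
- by rewrite /shift => x ? ?; rewrite add0r; apply: RX3.
(* The condition [sum_lift] survives the shift, because the subtracted values sum to
   [(a + b + c) *m X = 0]. *)
move=> a b c; rewrite /zero_sum !rel_dom_shift => zs.
have [w1 [w2 [w3 [Rw1 Rw2 Rw3 w0]]]] := lift3 _ _ _ zs.
exists (w1 - a *m X), (w2 - b *m X), (w3 - c *m X); rewrite /shift !subrK; split=> //.
by rewrite addr3ACA w0 add0r -!opprD -!mulmxDl; case: zs => _ _ _ ->; rewrite mul0mx oppr0.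
Qed.

(** Shifting by a selection of the intersection of the three relations makes 0 admissible on the
    common domain. The same matrix is subtracted from all three, so the pair and sum conditions are
    preserved. *)
Lemma common_lift_exists R1 R2 R3 : lin_rel R1 -> lin_rel R2 -> lin_rel R3 ->
  (forall x, rel_dom R1 x -> rel_dom R2 x -> rel_dom R3 x ->
     exists w, [/\ R1 x w, R2 x w & R3 x w]) ->
  pair_lift R1 R2 -> pair_lift R1 R3 -> pair_lift R2 R3 ->
  sum_lift R1 R2 R3 -> common_lift R1 R2 R3.
Proof.
move=> L1 L2 L3 P123 P12 P13 P23 lift3.
have [X [RX _]] := lin_rel_select_null (lin_rel_cap L1 (lin_rel_cap L2 L3)).
have shift_pair R S : pair_lift R S -> pair_lift (shift R X) (shift S X).
  move=> RS x; rewrite !rel_dom_shift => Rx Sx; have [w [Rw Sw]] := RS _ Rx Sx.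
  by exists (w - x *m X); rewrite /rel_cap /shift !subrK.
apply: (@common_lift_shift _ _ _ X); apply: common_lift_triple_null;
  rewrite ?rel_dom_shift; try exact: lin_rel_shift; try exact: shift_pair.
  move=> x R1x R2x R3x; rewrite /shift add0r.
  have [|? []] := RX x; last by split.
  by have [w [? ? ?]] := P123 _ R1x R2x R3x; exists w.
move=> a b c; rewrite /zero_sum !rel_dom_shift => zs.
have [w1 [w2 [w3 [Rw1 Rw2 Rw3 w0]]]] := lift3 _ _ _ zs.
exists (w1 - a *m X), (w2 - b *m X), (w3 - c *m X); rewrite /shift !subrK; split=> //.
by rewrite addr3ACA w0 add0r -!opprD -!mulmxDl; case: zs => _ _ _ ->; rewrite mul0mx oppr0.
Qed.
End ThreeRelations.
End LinearRelations.

(** * Rank over a division ring, computed with bases of row spaces *)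

Section Rank.
Variable K : unitRingType.
Hypothesis divK : division_ring K.

Lemma row_submxP m n k (A : 'M[K]_(m, n)) (B : 'M[K]_(k, n)) :
  (forall u : 'rV_m, exists w : 'rV_k, u *m A = w *m B) -> exists X, A = X *m B.
Proof.
move=> AB; have [f fE] := choice (fun i => AB (delta_mx 0 i)).
exists (\matrix_i f i); apply/row_matrixP => i.
by rewrite row_mul rowK -fE -rowE.
Qed.

Lemma left_rank_factor m n (A : 'M[K]_(m, n)) :
  exists (V : 'M[K]_(left_rank A, n)) U U',
    [/\ left_free V, V = U *m A & A = U' *m V].
Proof.
have [V [freeV VA]] := left_rank_basis divK A; exists V.
have [|U UE] := @row_submxP _ _ _ V A.
  move=> u; have : left_row_space A (u *m V) by rewrite -VA; exists u.
  by case=> w _ <-; exists w.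
have [|U' U'E] := @row_submxP _ _ _ A V.
  move=> u; have : left_row_space V (u *m A) by rewrite VA; exists u.
  by case=> w _ <-; exists w.
by exists U, U'.
Qed.

Lemma left_rankE m n r (A : 'M[K]_(m, n)) (V : 'M[K]_(r, n)) U U' :
  left_free V -> V = U *m A -> A = U' *m V -> left_rank A = r.
Proof.
move=> freeV VA AV; apply: (left_dimE divK (V := V)); split=> //.
apply/seteqP; split=> _ [u _ <-].
  by exists (u *m U); rewrite // -mulmxA -VA.
by exists (u *m U'); rewrite // -mulmxA -AV.
Qed.

(** A vector of the row space of [T] outside the span of [N] could be adjoined to [N], giving a free
    family longer than the rank. *)
Lemma left_free_span m n r (T : 'M[K]_(m, n)) (N : 'M[K]_(r, n)) X :
  left_free N -> N = X *m T -> left_rank T = r -> exists Q, T = Q *m N.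
Proof.
move=> freeN NT rT; apply: row_submxP => u; apply: contrapT => uN.
have [V [_ VT]] := left_rank_basis divK T.
suff : (1 + r <= left_rank T)%N by rewrite rT add1n ltnn.
apply: (left_basis_leq divK (V := col_mx (u *m T) N) (W := V)); last first.
  rewrite VT => _ [w _ <-]; exists (lsubmx w *m u + rsubmx w *m X) => //.
  by rewrite mulmxDl -!mulmxA -NT -mul_row_col hsubmxK.
move=> w; rewrite -[w]hsubmxK mul_row_col [lsubmx w]mx11_scalar mul_scalar_mx.
set c := lsubmx w 0 0; have [->|/divK Uc] := eqVneq c 0.
  by rewrite scale0r add0r => /freeN->; rewrite raddf0 row_mx0.
move=> /addr0_eq wE; case: uN; exists (- c^-1 *: rsubmx w).
by rewrite -scalemxAl -wE scalerN scaleNr opprK scalerA mulVr // scale1r.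
Qed.

(** Rank-nullity for [P] acting on the row space of [T]: the row space of [B] lies in the kernel,
    and the ranks add up exactly when it fills the kernel. The rank criteria below are instances. *)
Lemma left_rank_add m n k l (T : 'M[K]_(m, n)) (P : 'M[K]_(n, k))
    (B : 'M[K]_(l, n)) Z :
  B = Z *m T -> B *m P = 0 ->
  left_rank T = (left_rank (T *m P) + left_rank B)%N <->
  (forall u : 'rV_m, u *m T *m P = 0 -> exists w, u *m T = w *m B).
Proof.
move=> BZ BP.
have [V [U [U' [freeV VU TU]]]] := left_rank_factor (T *m P).
have [W [Y [Y' [freeW WY BY]]]] := left_rank_factor B.
(* Preimages of a basis of the row space of [T *m P], stacked on a basis of the row space of [B]. *)
pose N := col_mx (U *m T) W.
have NP (u : 'rV_(_ + _)) : u *m N *m P = lsubmx u *m V.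
  rewrite -[u]hsubmxK mul_row_col mulmxDl row_mxKl WY -!mulmxA BP !mulmx0 addr0.
  by rewrite -VU.
have freeN : left_free N.
  move=> u uN; have /freeV ul : lsubmx u *m V = 0 by rewrite -NP uN mul0mx.
  have := uN; rewrite -[u]hsubmxK mul_row_col ul mul0mx add0r => /freeW ->.
  by rewrite row_mx0.
have NT : N = col_mx U (Y *m Z) *m T by rewrite mul_col_mx -mulmxA -BZ -WY.
split=> [rT u | TB].
  have [Q ->] := left_free_span freeN NT rT.
  rewrite mulmxA NP => /freeV ul; exists (rsubmx (u *m Q) *m Y).
  by rewrite -[u *m Q]hsubmxK mul_row_col ul mul0mx add0r row_mxKr -mulmxA -WY.
have [u | Q TQ] := @row_submxP _ _ _ T N.
  (* Removing the chosen preimage of [u *m T *m P] leaves a vector of the kernel. *)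
  have [|w wE] := TB (u - u *m U' *m U).
    by rewrite -mulmxA mulmxBl -(mulmxA (u *m U')) -VU -mulmxA -TU subrr.
  exists (row_mx (u *m U') (w *m Y')); rewrite mul_row_col -[w *m Y' *m W]mulmxA -BY -wE.
  by rewrite mulmxBl !mulmxA addrC subrK.
exact: left_rankE freeN NT TQ.
Qed.

Lemma left_rank_eq m l n (A : 'M[K]_(m, n)) (B : 'M[K]_(l, n)) X Y :
  A = X *m B -> B = Y *m A -> left_rank A = left_rank B.
Proof.
move=> AB BA; have [V [U [U' [freeV VU BU]]]] := left_rank_factor B.
apply: (left_rankE (U := U *m Y) (U' := X *m U') freeV).
  by rewrite -mulmxA -BA.
by rewrite -mulmxA -BU.
Qed.

(** As [Q] undoes [P] on the row space of [A], a row basis stays free after multiplication by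
    [P]. *)
Lemma left_rank_mulr m n k (A : 'M[K]_(m, n)) (P : 'M[K]_(n, k)) Q :
  A *m P *m Q = A -> left_rank (A *m P) = left_rank A.
Proof.
move=> APQ; have [V [U [U' [freeV VU AU]]]] := left_rank_factor A.
have VPQ : V *m P *m Q = V by rewrite {1}VU -2!mulmxA [A *m _]mulmxA APQ -VU.
apply: (left_rankE (V := V *m P) (U := U) (U' := U')).
- by move=> u uVP; apply: freeV; rewrite -VPQ 2!mulmxA -(mulmxA u) uVP mul0mx.
- by rewrite VU mulmxA.
- by rewrite mulmxA -AU.
Qed.

Lemma left_rank0r m (A : 'M[K]_(m, 0)) : left_rank A = 0%N.
Proof.
apply: (left_rankE (V := 0 : 'M_(0, 0)) (U := 0) (U' := 0)).
- by move=> u _; rewrite [u]thinmx0.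
- by rewrite mul0mx.
- by rewrite [A]thinmx0 mulmx0.
Qed.

Lemma left_rank0l n (A : 'M[K]_(0, n)) : left_rank A = 0%N.
Proof.
apply: (left_rankE (V := A) (U := 1%:M) (U' := 1%:M)); rewrite ?mul1mx //.
by move=> u _; rewrite [u]thinmx0.
Qed.

(** In [left_rank_add], take for [P] the projection onto the columns of [A] and a [B] without rows:
    the kernel has to be zero. *)
Lemma left_rank_row m n k (A : 'M[K]_(m, n)) (M : 'M[K]_(m, k)) :
  left_rank (row_mx A M) = left_rank A <->
  (forall u : 'rV_m, u *m A = 0 -> u *m M = 0).
Proof.
have := @left_rank_add _ _ _ 0 (row_mx A M) (col_mx 1%:M 0) 0 0.
rewrite mul0mx mul0mx mul_row_col mulmx1 mulmx0 addr0 left_rank0l addn0.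
move=> /(_ erefl erefl) ->; split=> AM u.
  move=> uA; have [|w] := AM u.
    by rewrite mul_mx_row mul_row_col mulmx0 addr0 mulmx1.
  by rewrite mulmx0 mul_mx_row -row_mx0 => /eq_row_mx [].
rewrite mul_mx_row mul_row_col mulmx1 mulmx0 addr0 => uA.
by exists 0; rewrite uA AM // row_mx0 mulmx0.
Qed.

(** In [left_rank_add], take a [P] without columns: the kernel is the whole row space. *)
Lemma left_rank_col m n k (A : 'M[K]_(m, n)) (M : 'M[K]_(k, n)) :
  left_rank (col_mx A M) = left_rank A <->
  (forall u : 'rV_k, exists w, u *m M = w *m A).
Proof.
have := @left_rank_add _ _ 0 _ (col_mx A M) 0 A (row_mx 1%:M 0).
rewrite mul_row_col mul1mx mul0mx addr0 !mulmx0 left_rank0r add0n.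
move=> /(_ erefl erefl) ->; split=> AM u.
  have [|w] := AM (row_mx 0 u); first by rewrite mulmx0.
  by rewrite mul_row_col mul0mx add0r => ->; exists w.
move=> _; have [w wE] := AM (rsubmx u); exists (lsubmx u + w).
by rewrite -[u]hsubmxK mul_row_col wE mulmxDl row_mxKl.
Qed.

(** Here [P] in [left_rank_add] projects onto the last [k] columns. The corner is a variable equal
    to 0 so that block matrices of zeros fit too. *)
Lemma left_rank_block m n k l (M : 'M[K]_(m, n)) (A : 'M[K]_(m, k))
    (B : 'M[K]_(l, n)) (Z : 'M[K]_(l, k)) : Z = 0 ->
  left_rank (col_mx (row_mx M A) (row_mx B Z)) = (left_rank A + left_rank B)%N <->
  (forall u : 'rV_m, u *m A = 0 -> exists w, u *m M = w *m B).
Proof.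
move=> ->.
have := @left_rank_add _ _ _ _ (col_mx (row_mx M A) (row_mx B 0))
  (col_mx 0 1%:M) (row_mx B 0) (row_mx 0 1%:M).
rewrite mul_row_col mul0mx mul1mx add0r mul_row_col !mulmx0 mul0mx add0r.
have -> : col_mx (row_mx M A) (row_mx B 0) *m col_mx 0 1%:M = col_mx A 0 :> 'M_(_, k).
  by rewrite mul_col_mx !mul_row_col !mulmx0 !mulmx1 !add0r.
have -> : left_rank (row_mx B 0 : 'M_(l, n + k)) = left_rank B.
  rewrite -[B in LHS]mulmx1 -[0 in LHS](mulmx0 _ B) -mul_mx_row.
  apply: (left_rank_mulr (Q := col_mx 1%:M 0)).
  by rewrite -mulmxA mul_row_col mulmx1 mulmx0 addr0 mulmx1.
have -> : left_rank (col_mx A 0 : 'M_(m + l, k)) = left_rank A.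
  apply: (left_rank_eq (X := col_mx 1%:M 0) (Y := row_mx 1%:M 0)).
    by rewrite mul_col_mx mul1mx mul0mx.
  by rewrite mul_row_col mul1mx mul0mx addr0.
move=> /(_ erefl erefl) ->; split=> AM u.
  move=> uA; have [|w] := AM (row_mx u 0).
    by rewrite mul_row_col mul0mx addr0 mul_mx_row mul_row_col !mulmx0 mulmx1 add0r.
  rewrite mul_row_col mul0mx addr0 !mul_mx_row => /eq_row_mx [-> _].
  by exists w.
rewrite -[u]hsubmxK mul_row_col !mul_mx_row add_row_mx mulmx0 addr0.
rewrite mul_row_col mulmx0 add0r mulmx1 => uA; have [w wE] := AM _ uA.
by exists (w + rsubmx u); rewrite uA wE mul_mx_row mulmx0 mulmxDl.
Qed.

(** * Re-association of blocks, and lifting criteria for the block patterns *)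

Lemma left_rank_cast m n m' n' (e : (m = m') * (n = n')) (A : 'M[K]_(m, n)) :
  left_rank (castmx e A) = left_rank A.
Proof. by case: e => em en; case: _ / em; case: _ / en; rewrite castmx_id. Qed.

Lemma left_rank_colA m1 m2 m3 n (X : 'M[K]_(m1, n)) (Y : 'M[K]_(m2, n))
    (Z : 'M[K]_(m3, n)) :
  left_rank (col_mx X (col_mx Y Z)) = left_rank (col_mx (col_mx X Y) Z).
Proof. by rewrite col_mxA left_rank_cast. Qed.

Lemma left_rank_rowA m n1 n2 n3 (X : 'M[K]_(m, n1)) (Y : 'M[K]_(m, n2))
    (Z : 'M[K]_(m, n3)) :
  left_rank (row_mx X (row_mx Y Z)) = left_rank (row_mx (row_mx X Y) Z).
Proof. by rewrite row_mxA left_rank_cast. Qed.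

Lemma col_row_mx m1 m2 n1 n2 (X : 'M[K]_(m1, n1)) (Y : 'M[K]_(m1, n2))
    (Z : 'M[K]_(m2, n1)) (W : 'M[K]_(m2, n2)) :
  col_mx (row_mx X Y) (row_mx Z W) = row_mx (col_mx X Z) (col_mx Y W).
Proof. by rewrite -block_mxEv block_mxEh. Qed.

Lemma left_rank_block12 m n k1 k2 l (M : 'M[K]_(m, n)) (A : 'M[K]_(m, k1))
    (B : 'M[K]_(m, k2)) (H : 'M[K]_(l, n)) :
  left_rank [vblock [hblock M, A, B]; [hblock H, 0, 0]]
    = (left_rank [hblock A, B] + left_rank H)%N <->
  (forall u : 'rV_m, u *m A = 0 -> u *m B = 0 -> exists w, u *m M = w *m H).
Proof.
rewrite (left_rank_block _ _ _ (row_mx0 _ _ _ _)); split=> AM u.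
  by move=> uA uB; apply: AM; rewrite mul_mx_row uA uB row_mx0.
by rewrite mul_mx_row -row_mx0 => /eq_row_mx []; apply: AM.
Qed.

Lemma left_rank_block21 m n1 n2 k1 k2 (M : 'M[K]_(m, n1)) (B : 'M[K]_(m, n2))
    (E : 'M[K]_(k1, n1)) (H : 'M[K]_(k2, n1)) :
  left_rank [vblock [hblock M, B]; [hblock E, 0]; [hblock H, 0]]
    = (left_rank B + left_rank [vblock E; H])%N <->
  (forall u : 'rV_m, u *m B = 0 -> exists w1 w2, u *m M = w1 *m E + w2 *m H).
Proof.
rewrite [col_mx (row_mx E _) _]col_row_mx (left_rank_block _ _ _ (col_mx0 _ _ _ _)).
split=> AM u /AM.
  by case=> w ->; exists (lsubmx w), (rsubmx w); rewrite -mul_row_col hsubmxK.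
by case=> w1 [w2 ->]; exists (row_mx w1 w2); rewrite mul_row_col.
Qed.

Lemma left_rank_block22 m s n1 n2 k1 k2 l1 l2
    (M : 'M[K]_(m, n1)) (N : 'M[K]_(s, n2)) (A : 'M[K]_(m, k1)) (B : 'M[K]_(m, k2))
    (C : 'M[K]_(s, k1)) (E : 'M[K]_(l1, n1)) (F : 'M[K]_(l1, n2)) (H : 'M[K]_(l2, n1)) :
  left_rank [vblock [hblock M, 0, A, B]; [hblock 0, N, C, 0];
                    [hblock E, F, 0, 0]; [hblock H, 0, 0, 0]]
    = (left_rank [vblock [hblock A, B]; [hblock C, 0]]
       + left_rank [vblock [hblock E, F]; [hblock H, 0]])%N <->
  (forall (u1 : 'rV_m) (u2 : 'rV_s),
     u1 *m A + u2 *m C = 0 -> u1 *m B = 0 ->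
     exists w1 w2, u1 *m M = w1 *m E + w2 *m H /\ u2 *m N = w1 *m F).
Proof.
(* Both sides are brought to a common form with columns outermost. *)
have blk := left_rank_block [vblock [hblock M, 0]; [hblock 0, N]]
  [vblock [hblock A, B]; [hblock C, 0]] [vblock [hblock E, F]; [hblock H, 0]]
  (Z := [vblock [hblock 0, 0]; [hblock 0, 0]]).
rewrite left_rank_colA !col_row_mx left_rank_rowA.
rewrite !col_row_mx in blk; rewrite blk ?col_mx0 ?row_mx0 // => {blk}.
split=> AM.
  move=> u1 u2 uAC uB; have [|w] := AM (row_mx u1 u2).
    by rewrite mul_mx_row !mul_row_col uAC uB mulmx0 addr0 row_mx0.
  rewrite -[w]hsubmxK !mul_mx_row !mul_row_col !mulmx0 addr0 add0r addr0.
  by move=> /eq_row_mx [-> ->]; exists (lsubmx w), (rsubmx w).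
move=> u; rewrite -[u]hsubmxK !mul_mx_row !mul_row_col !mulmx0 !addr0 add0r.
rewrite -[0]row_mx0 => /eq_row_mx [uAC uB].
have [w1 [w2 [-> ->]]] := AM _ _ uAC uB; exists (row_mx w1 w2).
by rewrite !mul_mx_row !mul_row_col !mulmx0 !addr0.
Qed.

Lemma left_rank_block22_1 m s n1 n2 k l
    (M : 'M[K]_(m, n1)) (N : 'M[K]_(s, n2)) (C : 'M[K]_(m, k)) (D : 'M[K]_(s, k))
    (F : 'M[K]_(l, n1)) (G : 'M[K]_(l, n2)) :
  left_rank [vblock [hblock M, 0, C]; [hblock 0, N, D]; [hblock F, G, 0]]
    = (left_rank [vblock C; D] + left_rank [hblock F, G])%N <->
  (forall (u1 : 'rV_m) (u2 : 'rV_s), u1 *m C + u2 *m D = 0 ->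
     exists w, u1 *m M = w *m F /\ u2 *m N = w *m G).
Proof.
have blk := left_rank_block [vblock [hblock M, 0]; [hblock 0, N]] [vblock C; D]
  [hblock F, G] (Z := 0).
rewrite left_rank_colA !col_row_mx left_rank_rowA.
rewrite !col_row_mx in blk; rewrite blk // => {blk}.
split=> AM.
  move=> u1 u2 uCD; have [|w] := AM (row_mx u1 u2); first by rewrite mul_row_col.
  rewrite !mul_mx_row !mul_row_col !mulmx0 addr0 add0r.
  by move=> /eq_row_mx [-> ->]; exists w.
move=> u; rewrite -[u]hsubmxK !mul_mx_row !mul_row_col !mulmx0 addr0 add0r => uCD.
by have [w [-> ->]] := AM _ _ uCD; exists w; rewrite mul_mx_row.
Qed.

(** With [N] and [O] negated, this concerns the common points [u1 *m A = - u2 *m C = - u3 *m D] of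
    three domains; [w1] is a common value there. *)
Lemma left_rank_block33_2 m s t n1 n2 n3 k1 k2 l1 l2
    (M : 'M[K]_(m, n1)) (N : 'M[K]_(s, n2)) (O : 'M[K]_(t, n3))
    (A : 'M[K]_(m, k1)) (B : 'M[K]_(m, k2)) (C : 'M[K]_(s, k1)) (D : 'M[K]_(t, k1))
    (E : 'M[K]_(l1, n1)) (F : 'M[K]_(l1, n2)) (G : 'M[K]_(l1, n3)) (H : 'M[K]_(l2, n1)) :
  left_rank [vblock [hblock M, 0, 0, A, A, B];
                    [hblock 0, N, 0, C, 0, 0];
                    [hblock 0, 0, O, 0, D, 0];
                    [hblock E, F, G, 0, 0, 0];
                    [hblock H, 0, 0, 0, 0, 0]]
    = (left_rank [vblock [hblock A, A, B]; [hblock C, 0, 0]; [hblock 0, D, 0]]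
       + left_rank [vblock [hblock E, F, G]; [hblock H, 0, 0]])%N <->
  (forall (u1 : 'rV_m) (u2 : 'rV_s) (u3 : 'rV_t),
     u1 *m A + u2 *m C = 0 -> u1 *m A + u3 *m D = 0 -> u1 *m B = 0 ->
     exists w1 w2, [/\ u1 *m M = w1 *m E + w2 *m H, u2 *m N = w1 *m F
                     & u3 *m O = w1 *m G]).
Proof.
have blk := left_rank_block
  (col_mx (col_mx (row_mx (row_mx M 0) 0) (row_mx (row_mx 0 N) 0)) (row_mx (row_mx 0 0) O))
  (col_mx (col_mx [hblock A, A, B] [hblock C, 0, 0]) [hblock 0, D, 0])
  (col_mx (row_mx (row_mx E F) G) (row_mx (row_mx H 0) 0))
  (Z := [vblock [hblock 0, 0, 0]; [hblock 0, 0, 0]]).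
rewrite 2![X in X = _ <-> _]left_rank_colA [left_rank (col_mx (row_mx A _) _)]left_rank_colA.
rewrite !col_row_mx 2![X in X = _ <-> _]left_rank_rowA
  [left_rank (row_mx (col_mx E _) _)]left_rank_rowA.
rewrite !col_row_mx in blk; rewrite blk ?col_mx0 ?row_mx0 // => {blk}.
split=> AM.
  move=> u1 u2 u3 uAC uAD uB; have [|w] := AM (row_mx (row_mx u1 u2) u3).
    by rewrite !mul_mx_row !mul_row_col !mulmx0 !addr0 uAC uAD uB !row_mx0.
  rewrite -[w]hsubmxK !mul_mx_row !mul_row_col !mulmx0 !addr0 !add0r.
  by move=> /eq_row_mx [/eq_row_mx [-> ->] ->]; exists (lsubmx w), (rsubmx w).
move=> u; rewrite -[u]hsubmxK -[lsubmx u]hsubmxK.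
rewrite !mul_mx_row !mul_row_col !mulmx0 !addr0 !add0r.
rewrite -[0]row_mx0 -[X in _ = row_mx _ X]row_mx0.
move=> /eq_row_mx [uAC /eq_row_mx [uAD uB]].
have [w1 [w2 [-> -> ->]]] := AM _ _ _ uAC uAD uB; exists (row_mx w1 w2).
by rewrite !mul_mx_row !mul_row_col !mulmx0 !addr0.
Qed.

(** This concerns zero-sum triples. The row block [E] is repeated so that [w1] and [w2] vary
    independently; with [N] and [O] negated, the values are [w1 + w2], [- w1] and [- w2]. *)
Lemma left_rank_block33_3 m s t n1 n2 n3 k1 k2 l1 l2
    (M : 'M[K]_(m, n1)) (N : 'M[K]_(s, n2)) (O : 'M[K]_(t, n3))
    (A : 'M[K]_(m, k1)) (B : 'M[K]_(m, k2)) (C : 'M[K]_(s, k1)) (D : 'M[K]_(t, k1))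
    (E : 'M[K]_(l1, n1)) (F : 'M[K]_(l1, n2)) (G : 'M[K]_(l1, n3)) (H : 'M[K]_(l2, n1)) :
  left_rank [vblock [hblock M, 0, 0, A, B];
                    [hblock 0, N, 0, C, 0];
                    [hblock 0, 0, O, D, 0];
                    [hblock E, F, 0, 0, 0];
                    [hblock E, 0, G, 0, 0];
                    [hblock H, 0, 0, 0, 0]]
    = (left_rank [vblock [hblock A, B]; [hblock C, 0]; [hblock D, 0]]
       + left_rank [vblock [hblock E, F, 0]; [hblock E, 0, G]; [hblock H, 0, 0]])%N <->
  (forall (u1 : 'rV_m) (u2 : 'rV_s) (u3 : 'rV_t),
     u1 *m A + u2 *m C + u3 *m D = 0 -> u1 *m B = 0 ->
     exists w1 w2 w3, [/\ u1 *m M = w1 *m E + w2 *m E + w3 *m H,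
       u2 *m N = w1 *m F & u3 *m O = w2 *m G]).
Proof.
have blk := left_rank_block
  (col_mx (col_mx (row_mx (row_mx M 0) 0) (row_mx (row_mx 0 N) 0)) (row_mx (row_mx 0 0) O))
  (col_mx (col_mx [hblock A, B] [hblock C, 0]) [hblock D, 0])
  [vblock (row_mx (row_mx E F) 0); (row_mx (row_mx E 0) G); (row_mx (row_mx H 0) 0)]
  (Z := [vblock [hblock 0, 0]; [hblock 0, 0]; [hblock 0, 0]]).
rewrite 2![X in X = _ <-> _]left_rank_colA [left_rank (col_mx (row_mx A _) _)]left_rank_colA.
rewrite !col_row_mx 2![X in X = _ <-> _]left_rank_rowA
  [left_rank (row_mx (col_mx E _) _)]left_rank_rowA.
rewrite !col_row_mx in blk; rewrite blk ?col_mx0 ?row_mx0 // => {blk}.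
split=> AM.
  move=> u1 u2 u3 uAC uB; have [|w] := AM (row_mx (row_mx u1 u2) u3).
    by rewrite !mul_mx_row !mul_row_col !mulmx0 !addr0 uAC uB !row_mx0.
  rewrite -[w]hsubmxK -[rsubmx w]hsubmxK !mul_mx_row !mul_row_col.
  rewrite !mulmx0 !addr0 !add0r addrA.
  move=> /eq_row_mx [/eq_row_mx [-> ->] ->].
  by exists (lsubmx w), (lsubmx (rsubmx w)), (rsubmx (rsubmx w)).
move=> u; rewrite -[u]hsubmxK -[lsubmx u]hsubmxK.
rewrite !mul_mx_row !mul_row_col !mulmx0 !addr0 !add0r.
rewrite -[0]row_mx0 => /eq_row_mx [uAC uB].
have [w1 [w2 [w3 [-> -> ->]]]] := AM _ _ _ uAC uB; exists (row_mx w1 (row_mx w2 w3)).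
by rewrite !mul_mx_row !mul_row_col !mulmx0 !addr0 add0r addrA.
Qed.
End Rank.

(** * Two-sided matrix equations, and the full system *)

Lemma two_sided_solvable (K : unitRingType) (divK : division_ring K) m n k l
    (M : 'M[K]_(m, n)) (A : 'M[K]_(m, k)) (B : 'M[K]_(l, n)) :
  (forall u : 'rV_m, u *m A = 0 -> exists w, u *m M = w *m B) ->
  exists Y Z, A *m Y + Z *m B = M.
Proof.
move=> MAB.
(* [Z] is chosen first, so that [M - Z *m B] vanishes on the left kernel of [A]. *)
have [|Z [RZ _]] := @lin_rel_select_null _ divK _ _
  (fun u w => u *m A = 0 /\ u *m M = w *m B).
  split=> [|c x y w v [xA xM] [yA yM]]; first by rewrite !mul0mx.
  by rewrite !mulmxDl -!scalemxAl xA yA xM yM scaler0 addr0.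
(* Since [u] is determined by [u *m A] up to that kernel, [u *m (M - Z *m B)] depends on [u *m A]
   only, and [Y] realizes this dependence. *)
have [|Y [RY _]] := @lin_rel_select_null _ divK _ _
  (fun x w => exists u, x = u *m A /\ w = u *m (M - Z *m B)).
  split=> [|c _ _ _ _ [u [-> ->]] [v [-> ->]]]; first by exists 0; rewrite !mul0mx.
  by exists (c *: u + v); rewrite !mulmxDl -!scalemxAl.
exists Y, Z; apply/row_matrixP => i; rewrite !rowE; set u := delta_mx 0 i.
have [|u' [uA uY]] := RY (u *m A); first by exists (u *m (M - Z *m B)), u.
have [|_] := RZ (u - u').
  have uu'A : (u - u') *m A = 0 by rewrite mulmxBl uA subrr.
  by have [w wE] := MAB _ uu'A; exists w.
rewrite !mulmxBl => uu'.
rewrite mulmxDr mulmxA uY mulmxBr !mulmxA.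
apply/eqP; rewrite -addrA [_ + u *m _ *m _]addrC -uu' addrC subrK //.
Qed.

Theorem theorem3p5 (K : unitRingType) (divK : division_ring K)
  (m p q s t p1 m1 s1 t1 q1 : nat)
  (A : 'M[K]_(m, p)) (B : 'M[K]_(m, q)) (C : 'M[K]_(s, p)) (D : 'M[K]_(t, p))
  (E : 'M[K]_(p1, m1)) (F : 'M[K]_(p1, s1)) (G : 'M[K]_(p1, t1))
  (H : 'M[K]_(q1, m1))
  (Phi : 'M[K]_(m, m1)) (Psi : 'M[K]_(s, s1)) (Omega : 'M[K]_(t, t1)) :
  (exists (X : 'M[K]_(p, p1)) (Y : 'M[K]_(q, m1)) (Z : 'M[K]_(m, q1)),
     [/\ A *m X *m E + B *m Y + Z *m H = Phi,
         C *m X *m F = Psi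
       & D *m X *m G = Omega])
  <->
  (left_rank [vblock [hblock Phi, A, B];
                     [hblock H,   0, 0]]
     = left_rank [hblock A, B] + left_rank H)%N /\
  left_rank [hblock C, Psi] = left_rank C /\
  left_rank [hblock D, Omega] = left_rank D /\
  (left_rank [vblock [hblock Phi, B];
                     [hblock E,   0];
                     [hblock H,   0]]
     = left_rank B + left_rank [vblock E; H])%N /\
  left_rank [vblock F; Psi] = left_rank F /\
  left_rank [vblock G; Omega] = left_rank G /\
  (left_rank [vblock [hblock Phi, 0,    A, B];
                     [hblock 0,   -Psi, C, 0];
                     [hblock E,   F,    0, 0];
                     [hblock H,   0,    0, 0]]
     = left_rank [vblock [hblock A, B]; [hblock C, 0]]
       + left_rank [vblock [hblock E, F]; [hblock H, 0]])%N /\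
  (left_rank [vblock [hblock Phi, 0,      A, B];
                     [hblock 0,   -Omega, D, 0];
                     [hblock E,   G,      0, 0];
                     [hblock H,   0,      0, 0]]
     = left_rank [vblock [hblock A, B]; [hblock D, 0]]
       + left_rank [vblock [hblock E, G]; [hblock H, 0]])%N /\
  (left_rank [vblock [hblock Psi, 0,      C];
                     [hblock 0,   -Omega, D];
                     [hblock F,   G,      0]]
     = left_rank [vblock C; D] + left_rank [hblock F, G])%N /\
  (left_rank [vblock [hblock Phi, 0,    0,      A, A, B];
                     [hblock 0,   -Psi, 0,      C, 0, 0];
                     [hblock 0,   0,    -Omega, 0, D, 0];
                     [hblock E,   F,    G,      0, 0, 0];
                     [hblock H,   0,    0,      0, 0, 0]]
     = left_rank [vblock [hblock A, A, B]; [hblock C, 0, 0]; [hblock 0, D, 0]]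
       + left_rank [vblock [hblock E, F, G]; [hblock H, 0, 0]])%N /\
  (left_rank [vblock [hblock Phi, 0,    0,      A, B];
                     [hblock 0,   -Psi, 0,      C, 0];
                     [hblock 0,   0,    -Omega, D, 0];
                     [hblock E,   F,    0,      0, 0];
                     [hblock E,   0,    G,      0, 0];
                     [hblock H,   0,    0,      0, 0]]
     = left_rank [vblock [hblock A, B]; [hblock C, 0]; [hblock D, 0]]
       + left_rank [vblock [hblock E, F, 0]; [hblock E, 0, G];
                           [hblock H, 0, 0]])%N.
Proof.
(* Each rank equality becomes a lifting condition on row vectors; both directions work with these
   conditions. *)
have k1 := left_rank_block12 divK Phi A B H.
have k2 := left_rank_row divK C Psi.
have k3 := left_rank_row divK D Omega.
have k4 := left_rank_block21 divK Phi B E H.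
have k5 := left_rank_col divK F Psi.
have k6 := left_rank_col divK G Omega.
have k7 := left_rank_block22 divK Phi (- Psi) A B C E F H.
have k8 := left_rank_block22 divK Phi (- Omega) A B D E G H.
have k9 := left_rank_block22_1 divK Psi (- Omega) C D F G.
have k10 := left_rank_block33_2 divK Phi (- Psi) (- Omega) A B C D E F G H.
have k11 := left_rank_block33_3 divK Phi (- Psi) (- Omega) A B C D E F G H.
split=> [[X [Y [Z [ePhi ePsi eOmega]]]] |].
  have rPhi (u : 'rV_m) : u *m B = 0 -> u *m Phi = u *m A *m X *m E + u *m Z *m H.
    by move=> uB; rewrite -ePhi !mulmxDr !mulmxA uB mul0mx addr0.
  have rPsi (u : 'rV_s) : u *m Psi = u *m C *m X *m F by rewrite -ePsi !mulmxA.
  have rOmega (u : 'rV_t) : u *m Omega = u *m D *m X *m G by rewrite -eOmega !mulmxA.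
  split; [|split; [|split; [|split; [|split; [|split; [|split; [|split; [|split; [|split]]]]]]]]].
  - by apply/k1 => u uA uB; exists (u *m Z); rewrite rPhi // uA !mul0mx add0r.
  - by apply/k2 => u uC; rewrite rPsi uC !mul0mx.
  - by apply/k3 => u uD; rewrite rOmega uD !mul0mx.
  - by apply/k4 => u uB; exists (u *m A *m X), (u *m Z); apply: rPhi.
  - by apply/k5 => u; exists (u *m C *m X).
  - by apply/k6 => u; exists (u *m D *m X).
  - apply/k7 => u1 u2 /addr0_eq uAC uB; exists (u1 *m A *m X), (u1 *m Z).
    by rewrite rPhi // mulmxN rPsi -uAC !mulNmx opprK.
  - apply/k8 => u1 u2 /addr0_eq uAD uB; exists (u1 *m A *m X), (u1 *m Z).
    by rewrite rPhi // mulmxN rOmega -uAD !mulNmx opprK.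
  - apply/k9 => u1 u2 /addr0_eq uCD; exists (u1 *m C *m X).
    by rewrite rPsi mulmxN rOmega -uCD !mulNmx opprK.
  - apply/k10 => u1 u2 u3 /addr0_eq uAC /addr0_eq uAD uB.
    exists (u1 *m A *m X), (u1 *m Z).
    by rewrite rPhi // !mulmxN rPsi rOmega -uAC -uAD !mulNmx !opprK.
  - apply/k11 => u1 u2 u3 uACD uB.
    (* The value of [X] at [u1 *m A] is split along [u1 *m A = - (u2 *m C) - u3 *m D]. *)
    exists (- (u2 *m C *m X)), (- (u3 *m D *m X)), (u1 *m Z).
    rewrite rPhi // !mulmxN rPsi rOmega !mulNmx; split=> //.
    have -> : u1 *m A = - (u2 *m C + u3 *m D).
      by apply/eqP; rewrite -addr_eq0 addrA uACD.
    by rewrite !mulNmx !mulmxDl opprD.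
case=> [/k1 c1 [/k2 c2 [/k3 c3 [/k4 c4 [/k5 c5 [/k6 c6 rest]]]]]].
case: rest => [/k7 c7 [/k8 c8 [/k9 c9 [/k10 c10 /k11 c11]]]].
(* The relations list the candidates [w] for [x *m X] in each equation. In [R1], the condition
   [u *m B = 0] eliminates [Y], and [v] stands for [u *m Z]. *)
pose R1 (x : 'rV[K]_p) (w : 'rV[K]_p1) :=
  exists u v, [/\ u *m B = 0, x = u *m A & u *m Phi = w *m E + v *m H].
pose R2 (x : 'rV[K]_p) (w : 'rV[K]_p1) := exists u, x = u *m C /\ u *m Psi = w *m F.
pose R3 (x : 'rV[K]_p) (w : 'rV[K]_p1) := exists u, x = u *m D /\ u *m Omega = w *m G.
have L1 : lin_rel R1.
  split=> [|c x y w v]; first by exists 0, 0; rewrite !mul0mx addr0.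
  move=> [u1 [v1 [uB1 -> e1]]] [u2 [v2 [uB2 -> e2]]]; exists (c *: u1 + u2), (c *: v1 + v2).
  rewrite !mulmxDl -!scalemxAl uB1 uB2 scaler0 addr0 e1 e2; split=> //.
  by rewrite scalerDr addrACA.
have L2 : lin_rel R2.
  split=> [|c x y w v]; first by exists 0; rewrite !mul0mx.
  move=> [u1 [-> e1]] [u2 [-> e2]]; exists (c *: u1 + u2).
  by rewrite !mulmxDl -!scalemxAl e1 e2.
have L3 : lin_rel R3.
  split=> [|c x y w v]; first by exists 0; rewrite !mul0mx.
  move=> [u1 [-> e1]] [u2 [-> e2]]; exists (c *: u1 + u2).
  by rewrite !mulmxDl -!scalemxAl e1 e2.
have [X [X1 X2 X3]] : common_lift R1 R2 R3.
  apply: (common_lift_exists divK) => //.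
  - move=> x [_ [u1 [_ [uB -> _]]]] [_ [u2 [uC _]]] [_ [u3 [uD _]]].
    (* The signs turn equal points into vanishing sums, and cancel against [- Psi] and [- Omega]. *)
    have [||w1 [w2 [e1 e2 e3]]] := c10 u1 (- u2) (- u3) _ _ uB.
    + by rewrite mulNmx -uC subrr.
    + by rewrite mulNmx -uD subrr.
    move: e2 e3; rewrite !mulmxN !mulNmx !opprK => e2 e3.
    by exists w1; split; [exists u1, w2 | exists u2 | exists u3].
  - move=> x [_ [u1 [_ [uB -> _]]]] [_ [u2 [uC _]]].
    have [|w1 [w2 [e1 e2]]] := c7 u1 (- u2) _ uB; first by rewrite mulNmx -uC subrr.
    move: e2; rewrite mulmxN mulNmx opprK => e2.
    by exists w1; split; [exists u1, w2 | exists u2].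
  - move=> x [_ [u1 [_ [uB -> _]]]] [_ [u2 [uD _]]].
    have [|w1 [w2 [e1 e2]]] := c8 u1 (- u2) _ uB; first by rewrite mulNmx -uD subrr.
    move: e2; rewrite mulmxN mulNmx opprK => e2.
    by exists w1; split; [exists u1, w2 | exists u2].
  - move=> x [_ [u1 [-> _]]] [_ [u2 [uD _]]].
    have [|w [e1 e2]] := c9 u1 (- u2); first by rewrite mulNmx -uD subrr.
    move: e2; rewrite mulmxN mulNmx opprK => e2.
    by exists w; split; [exists u1 | exists u2].
  move=> _ _ _ [[_ [u1 [_ [uB -> _]]]] [_ [u2 [-> _]]] [_ [u3 [-> _]]] s0].
  have [w1 [w2 [w3 [e1 e2 e3]]]] := c11 _ _ _ s0 uB.
  exists (w1 + w2), (- w1), (- w2); split.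
  + by exists u1, w3; rewrite mulmxDl.
  + by exists u2; rewrite mulNmx -e2 mulmxN opprK.
  + by exists u3; rewrite mulNmx -e3 mulmxN opprK.
  by rewrite -addrA -opprD subrr.
exists X.
have [u uB|Y [Z YZ]] := @two_sided_solvable _ divK _ _ _ _ (Phi - A *m X *m E) B H.
  have [w1 [w2 e]] := c4 _ uB.
  (* By [c4], [u *m A] is in the domain of [R1]. The selection yields some [u'] with the same image
     under [A]; [u - u'] annihilates [A] and [B], so [c1] puts [(u - u') *m Phi] in the row space of
     [H]. *)
  have [|u' [v [u'B uA e']]] := X1 (u *m A); first by exists w1, u, w2.
  have [||w3 e3] := c1 (u - u').
  - by rewrite mulmxBl uA subrr.
  - by rewrite mulmxBl uB u'B subrr.
  exists (w3 + v); rewrite mulmxBr !mulmxA mulmxDl -e3 mulmxBl e'.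
  by rewrite opprD addrA subrK.
exists Y, Z; split.
- by rewrite -addrA YZ addrC subrK.
- apply/row_matrixP => i; rewrite !rowE !mulmxA; set u := delta_mx 0 i.
  (* [c5] puts [u *m C] in the domain of [R2], and [c2] makes [u *m Psi] independent of the
     representative [u]. *)
  have [w wE] := c5 u; have [|u' [uC e]] := X2 (u *m C); first by exists w, u.
  rewrite -e; apply/eqP; rewrite -subr_eq0 -mulmxBl; apply/eqP/c2.
  by rewrite mulmxBl uC subrr.
- apply/row_matrixP => i; rewrite !rowE !mulmxA; set u := delta_mx 0 i.
  have [w wE] := c6 u; have [|u' [uD e]] := X3 (u *m D); first by exists w, u.
  rewrite -e; apply/eqP; rewrite -subr_eq0 -mulmxBl; apply/eqP/c3.
  by rewrite mulmxBl uD subrr.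
Qed.
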